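(* Let $S$ be a unital inverse semigroup acting on a topological space $Z$ by partial homeomorphisms, let $S\ltimes Z$ be the (étale) groupoid of germs, and let $L$ be a topological groupoid. A groupoid fibration $F\colon L\to S\ltimes Z$ with fibre $G$ is equivalent to an $S$-grading $(L_t)_{t\in S}$ on $L$ with $L_1=G$ (so that $L$ is the transformation groupoid $S\ltimes G$ for an action of $S$ on $G$ by partial equivalences) together with a $G$-invariant continuous map $G^0=L^0\to Z$ that is $S$-equivariant for the induced action of $S$ on $G^0/G$.
   Context: A topological groupoid $L$ has (arbitrary) topological spaces $L^0$ of objects and $L^1$ of arrows, open continuous range and source maps $r,s\colon L^1\to L^0$, and continuous multiplication, inversion and unit maps. A groupoid fibration is a continuous functor $F\colon L\to H$ between topological groupoids (continuous maps $F^i\colon L^i\to H^i$, $i=0,1$, compatible with $r$, $s$ and multiplication) such that $(F^1,s)\colon L^1\to H^1\times_{s,H^0,F^0}L^0=\{(h,x)\in H^1\times L^0: s(h)=F^0(x)\}$ is an open surjection. Its fibre is the subgroupoid $G\subseteq L$ with $G^0=L^0$ and $G^1=\{g\in L^1: F^1(g)=1_{F^0(s(g))}\}$, with the subspace topology. An action of $S$ on $Z$ assigns to $t\in S$ a homeomorphism $D_{t^*t}\to D_{tt^*}$, $z\mapsto t\cdot z$, between open subsets of $Z$, compatibly with products as partial maps and with $1$ acting as the identity on $Z$. The groupoid of germs $S\ltimes Z$ has object space $Z$; its arrows are germs $[t,z]$ with $t\in S$, $z\in D_{t^*t}$, where $[t,z]=[u,z']$ iff $z=z'$ and there is an idempotent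 $e\in S$ with $z\in D_e$ and $te=ue$. Moreover $s([t,z])=z$, $r([t,z])=t\cdot z$, $[t,u\cdot z][u,z]=[tu,z]$, and the sets $\{[t,z]: z\in V\}$ for $t\in S$ and $V\subseteq D_{t^*t}$ open form a basis of the topology on arrows. An $S$-grading on $L$ is a family of open subsets $L_t\subseteq L^1$, $t\in S$, with $L_t\cdot L_u=L_{tu}$, $L_t^{-1}=L_{t^*}$, $L_t\cap L_u=\bigcup_{v\in S,\,v\le t,u}L_v$ for all $t,u\in S$, and $\bigcup_{t\in S}L_t=L^1$. The condition $L_1=G$ means that $L_1$ is the arrow space of the subgroupoid $G$, which has $G^0=L^0$. An action of $S$ on the groupoid $G$ by partial equivalences with transformation groupoid $L=S\ltimes G$ is the same as an $S$-grading on $L$ with $L_1=G$. Given such a grading, the induced action of $S$ on the orbit space $G^0/G$ is as follows: $t\in S$ acts from the image of the $G$-invariant open set $U_{t^*t}=s(L_t)$ to the image of $U_{tt^*}=r(L_t)$ by $t\cdot[x]=[r(l)]$ for any $l\in L_t$ with $s(l)=x$. A $G$-invariant continuous map $\rho\colon G^0\to Z$ descends to a map on $G^0/G$; it is $S$-equivariant if $\rho^{-1}(D_{t^*t})=U_{t^*t}$ and $\rho(t\cdot[x])=t\cdot\rho(x)$ for all $t\in S$, $x\in U_{t^*t}$. *)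

(* Defs.v *)
From HB Require Import structures.
From mathcomp Require Import all_boot all_classical topology.

Set Implicit Arguments.
Unset Strict Implicit.
Unset Printing Implicit Defensive.

Local Open Scope classical_set_scope.
Local Open Scope group_scope.
Local Open Scope quotient_scope.

HB.mixin Record Monoid_isInverse S & Monoid S := {
  star : S -> S;
  mulg_starK : forall t : S, t * star t * t = t;
  star_mulgK : forall t : S, star t * t * star t = star t;
  star_uniq : forall t u : S, t * u * t = t -> u * t * u = u -> u = star t
}.

#[short(type="invMonoidType")]
HB.structure Definition InverseMonoid := {S of Monoid S & Monoid_isInverse S}.

Notation "t ^*" := (star t) : group_scope.

Definition idemp (S : monoidType) (e : S) := e * e = e.

(* the natural partial order v <= t *)
Definition nat_le (S : monoidType) (v t : S) := exists2 e, idemp e & v = t * e.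

Section InverseMonoidTheory.
Variable S : invMonoidType.
Implicit Types t u e f : S.

Lemma idemp_star e : idemp e -> e^* = e.
Proof. by move=> ee; apply/esym/star_uniq; rewrite !ee. Qed.

Lemma starK t : t^*^* = t.
Proof. by apply/esym/star_uniq; [exact: star_mulgK|exact: mulg_starK]. Qed.

Lemma idemp_starl t : idemp (t^* * t).
Proof. by rewrite /idemp mulgA star_mulgK. Qed.

Lemma idemp_starr t : idemp (t * t^*).
Proof. by rewrite /idemp mulgA mulg_starK. Qed.

Lemma idempM e f : idemp e -> idemp f -> idemp (e * f).
Proof.
move=> ee ff; set x := (e * f)^*.
have x1 : e * f * x * (e * f) = e * f by exact: mulg_starK.
have x2 : x * (e * f) * x = x by exact: star_mulgK.
have xE : f * x * e = x.
  apply: star_uniq.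
    rewrite -[RHS]x1 -!mulgA (mulgA f f) ff (mulgA e e) ee.
    by rewrite !mulgA.
  rewrite -!mulgA (mulgA e e) ee (mulgA f f) ff.
  by rewrite -[in RHS]x2 !mulgA.
have xx : idemp x.
  rewrite /idemp -[in LHS]xE -[RHS]xE -[in RHS]x2.
  by rewrite !mulgA.
by rewrite -(starK (e * f)) -/x (idemp_star xx).
Qed.

Lemma idempC e f : idemp e -> idemp f -> e * f = f * e.
Proof.
move=> ee ff; have ef := idempM ee ff; have fe := idempM ff ee.
rewrite -[LHS](idemp_star ef); apply/esym/star_uniq.
  by rewrite -!mulgA (mulgA f f) ff (mulgA e e) ee !mulgA -mulgA ef.
by rewrite -!mulgA (mulgA e e) ee (mulgA f f) ff !mulgA -mulgA fe.
Qed.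

Lemma starM t u : (t * u)^* = u^* * t^*.
Proof.
have c := idempC (idemp_starr u) (idemp_starl t).
apply/esym/star_uniq.
  transitivity (t * (u * u^* * (t^* * t)) * u); first by rewrite !mulgA.
  by rewrite c !mulgA mulg_starK -!mulgA (mulgA u) mulg_starK.
transitivity (u^* * (t^* * t * (u * u^*)) * t^*); first by rewrite !mulgA.
by rewrite -c !mulgA star_mulgK -!mulgA (mulgA t^*) star_mulgK.
Qed.

Lemma star1 : 1^* = 1 :> S.
Proof. by apply: idemp_star; rewrite /idemp mulg1. Qed.

Lemma idemp_conj u e : idemp e -> idemp (u^* * e * u).
Proof.
move=> ee; rewrite /idemp -!mulgA (mulgA u) (mulgA e (u * u^*)).
rewrite (idempC ee (idemp_starr u)) !mulgA star_mulgK.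
by rewrite -(mulgA u^* e e) ee.
Qed.

Lemma idemp_conjr u e : idemp e -> e * u = u * (u^* * e * u).
Proof.
by move=> ee; rewrite !mulgA -(idempC ee (idemp_starr u)) -!mulgA (mulgA u) mulg_starK.
Qed.

End InverseMonoidTheory.

Definition open_map (X Y : topologicalType) (f : X -> Y) :=
  forall U, open U -> open (f @` U).

Record partial_homeo (X Y : topologicalType) (A : set X) (B : set Y)
    (f : X -> Y) : Prop := PartialHomeo {
  phomeo_domain : open A;
  phomeo_codomain : open B;
  phomeo_bij : set_bij A B f;
  phomeo_continuous : {within A, continuous f};
  phomeo_open : forall U, U `<=` A -> open U -> open (f @` U) }.

(* Only the sets [adom e] for e idempotent and the values of [act t] on
   [adom (t^* * t)] are meaningful. *)
Record action (S : invMonoidType) (Z : topologicalType) := Action {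
  adom : S -> set Z;
  act : S -> Z -> Z;
  act_homeo : forall t, partial_homeo (adom (t^* * t)) (adom (t * t^*)) (act t);
  adom_mul : forall t u,
    adom ((t * u)^* * (t * u)) = adom (u^* * u) `&` act u @^-1` adom (t^* * t);
  act_mul : forall t u z,
    adom ((t * u)^* * (t * u)) z -> act (t * u) z = act t (act u z);
  adom_one : adom (1^* * 1) = setT;
  act_one : forall z, act 1 z = z }.

Section ActionTheory.
Variables (S : invMonoidType) (Z : topologicalType) (a : action S Z).
Implicit Types (t u e f : S) (z : Z).

Lemma adom_open t : open (adom a (t^* * t)).
Proof. exact: phomeo_domain (act_homeo a t). Qed.

Lemma adom_idemp_open e : idemp e -> open (adom a e).
Proof. by move=> ee; have := adom_open e; rewrite (idemp_star ee) ee. Qed.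

Lemma act_codomain t z : adom a (t^* * t) z -> adom a (t * t^*) (act a t z).
Proof. by have [_ _ [+ _ _] _ _] := act_homeo a t; apply. Qed.

Lemma act_idemp e z : idemp e -> adom a e z -> act a e z = z.
Proof.
move=> ee ez; have [_ _ [+ + _] _ _] := act_homeo a e.
have := @act_mul _ _ a e e z; rewrite ee (idemp_star ee) ee => /(_ ez) h fe inj.
by apply: inj; rewrite ?inE //; exact: fe.
Qed.

Lemma adom_mul_idemp t e z : idemp e ->
  adom a ((t * e)^* * (t * e)) z <-> adom a e z /\ adom a (t^* * t) z.
Proof.
move=> ee; rewrite adom_mul (idemp_star ee) ee; split=> -[ez /=].
  by rewrite act_idemp.
by move=> tz; split => //=; rewrite act_idemp.
Qed.

Lemma adom_idempM e f z : idemp e -> idemp f -> adom a (e * f) z <-> adom a e z /\ adom a f z.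
Proof.
move=> ee ff; have ef := idempM ee ff.
have := @adom_mul_idemp e f z ff; rewrite (idemp_star ef) ef (idemp_star ee) ee.
by move=> ->; split=> -[].
Qed.

Lemma act_mul_idemp t e z : idemp e -> adom a e z -> adom a (t^* * t) z ->
  act a (t * e) z = act a t z.
Proof.
by move=> ee ez tz; rewrite act_mul ?(act_idemp ee ez)//; apply/(adom_mul_idemp t z ee).
Qed.

Lemma adom_star t z : adom a (t^* * t) z -> adom a (t^*^* * t^*) (act a t z).
Proof. by rewrite starK; exact: act_codomain. Qed.

Lemma actK t z : adom a (t^* * t) z -> act a t^* (act a t z) = z.
Proof.
move=> tz; rewrite -act_mul ?act_idemp//; first exact: idemp_starl.
by rewrite (idemp_star (idemp_starl t)) idemp_starl.
Qed.

Lemma adom_mulP t u z : adom a (u^* * u) z -> adom a (t^* * t) (act a u z) ->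
  adom a ((t * u)^* * (t * u)) z.
Proof. by move=> uz tz; rewrite adom_mul. Qed.

Lemma germ_eq_act t u e z : idemp e -> adom a e z -> t * e = u * e ->
  adom a (t^* * t) z -> adom a (u^* * u) z /\ act a t z = act a u z.
Proof.
move=> ee ez teue tz.
have uz : adom a (u^* * u) z.
  by apply: (proj2 ((adom_mul_idemp u z ee).1 _)); rewrite -teue; apply/(adom_mul_idemp t z ee).
by split=> //; rewrite -(act_mul_idemp ee ez tz) teue act_mul_idemp.
Qed.

End ActionTheory.

(* Multiplication is a total function, but only products of composable
   arrows are meaningful. *)
Record topGroupoid := TopGroupoid {
  obj : topologicalType;
  arr : topologicalType;
  rng : arr -> obj;
  src : arr -> obj;
  gmul : arr -> arr -> arr;
  ginv : arr -> arr;
  gunit : obj -> arr;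
  rng_continuous : continuous rng;
  rng_open : open_map rng;
  src_continuous : continuous src;
  src_open : open_map src;
  gmul_continuous : {within [set gh : arr * arr | src gh.1 = rng gh.2],
    continuous (fun gh => gmul gh.1 gh.2)};
  ginv_continuous : continuous ginv;
  gunit_continuous : continuous gunit;
  rng_gunit : forall x, rng (gunit x) = x;
  src_gunit : forall x, src (gunit x) = x;
  rng_gmul : forall g h, src g = rng h -> rng (gmul g h) = rng g;
  src_gmul : forall g h, src g = rng h -> src (gmul g h) = src h;
  gmulA : forall g h k, src g = rng h -> src h = rng k ->
    gmul g (gmul h k) = gmul (gmul g h) k;
  gunit_gmul : forall g, gmul (gunit (rng g)) g = g;
  gmul_gunit : forall g, gmul g (gunit (src g)) = g;
  rng_ginv : forall g, rng (ginv g) = src g;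
  src_ginv : forall g, src (ginv g) = rng g;
  ginv_gmul : forall g, gmul (ginv g) g = gunit (src g);
  gmul_ginv : forall g, gmul g (ginv g) = gunit (rng g) }.

Record functor (L H : topGroupoid) := Functor {
  fobj : obj L -> obj H;
  farr : arr L -> arr H;
  fobj_continuous : continuous fobj;
  farr_continuous : continuous farr;
  rng_farr : forall g, rng (farr g) = fobj (rng g);
  src_farr : forall g, src (farr g) = fobj (src g);
  farr_gmul : forall g h, src g = rng h ->
    farr (gmul g h) = gmul (farr g) (farr h) }.

(* a subgroupoid of L with the same objects as L *)
Record wide_subgroupoid (L : topGroupoid) := WideSubgroupoid {
  sub_arr :> set (arr L);
  sub_gunit : forall x, sub_arr (gunit x);
  sub_gmul : forall g h, src g = rng h ->
    sub_arr g -> sub_arr h -> sub_arr (gmul g h);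
  sub_ginv : forall g, sub_arr g -> sub_arr (ginv g) }.

Section Fibration.
Variables (L H : topGroupoid) (F : functor L H).

Definition fibre_product : set (arr H * obj L) :=
  [set hx | src hx.1 = fobj F hx.2].

Lemma farr_src_in g : (farr F g, src g) \in fibre_product.
Proof. by rewrite inE /fibre_product /= src_farr. Qed.

(* the map (F^1, s), with values in the subspace [fibre_product] *)
Definition farr_src (g : arr L) : fibre_product := 
  exist (fun hx => hx \in fibre_product) (farr F g, src g) (farr_src_in g).

Definition is_fibration := open_map farr_src /\ set_surj setT setT farr_src.

Lemma gidem_unit (K : topGroupoid) (g : arr K) :
  src g = rng g -> gmul g g = g -> g = gunit (src g).
Proof.
move=> sr gg; rewrite -[LHS]gunit_gmul -sr -ginv_gmul.
by rewrite -gmulA ?src_ginv // gg ginv_gmul.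
Qed.

Lemma farr_gunit x : farr F (gunit x) = gunit (fobj F x).
Proof.
rewrite [LHS]gidem_unit ?src_farr ?rng_farr ?src_gunit ?rng_gunit//.
rewrite -farr_gmul ?src_gunit ?rng_gunit//.
by rewrite -[X in gmul _ (gunit X)](src_gunit x) gmul_gunit.
Qed.

Lemma farr_ginv g : farr F (ginv g) = ginv (farr F g).
Proof.
rewrite -[LHS]gmul_gunit src_farr src_ginv -rng_farr -gmul_ginv.
rewrite gmulA ?src_farr ?rng_farr ?rng_ginv ?src_ginv ?src_farr//.
rewrite -farr_gmul ?src_ginv// ginv_gmul farr_gunit -src_farr.
by rewrite -(rng_ginv (farr F g)) gunit_gmul.
Qed.

Definition fibre_set : set (arr L) :=
  [set g | farr F g = gunit (fobj F (src g))].

Lemma fibre_gunit x : fibre_set (gunit x).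
Proof. by rewrite /fibre_set /= farr_gunit src_gunit. Qed.

Lemma fibre_rng g : fibre_set g -> fobj F (rng g) = fobj F (src g).
Proof. by move=> Gg; rewrite -rng_farr Gg rng_gunit. Qed.

Lemma fibre_gmul g h : src g = rng h ->
  fibre_set g -> fibre_set h -> fibre_set (gmul g h).
Proof.
move=> gh Gg Gh; rewrite /fibre_set /= farr_gmul// src_gmul// Gg gh.
rewrite (fibre_rng Gh) Gh -[X in gmul _ (gunit X)](src_gunit (fobj F (src h))).
by rewrite gmul_gunit.
Qed.

Lemma fibre_ginv g : fibre_set g -> fibre_set (ginv g).
Proof.
move=> Gg; rewrite /fibre_set /= farr_ginv src_ginv (fibre_rng Gg) Gg.
set y := fobj F _; rewrite -[LHS]gmul_gunit src_ginv rng_gunit.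
by rewrite ginv_gmul src_gunit.
Qed.

Definition fibre : wide_subgroupoid L :=
  WideSubgroupoid fibre_gunit fibre_gmul fibre_ginv.

End Fibration.

Section Germs.
Variables (S : invMonoidType) (Z : topologicalType) (a : action S Z).

Definition germ_dom : set (S * Z) := [set p | adom a (p.1^* * p.1) p.2].

Definition germ_pair : choiceType := {p : S * Z | p \in germ_dom}.

Implicit Types p q : germ_pair.

Definition germ_rel : rel germ_pair := fun p q =>
  `[< (val p).2 = (val q).2 /\ exists e : S,
      [/\ idemp e, adom a e (val p).2 & (val p).1 * e = (val q).1 * e] >].

Lemma germ_rel_refl : reflexive germ_rel.
Proof.
move=> p; apply/asboolP; split=> //; exists (1^* * 1).
by split=> //; [exact: idemp_starl|rewrite adom_one].
Qed.

Lemma germ_rel_sym : symmetric germ_rel.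
Proof.
suff s p q : germ_rel p q -> germ_rel q p by move=> p q; apply/idP/idP; exact: s.
move=> /asboolP[pq [e [ee ez pe]]]; apply/asboolP; split=> //; exists e.
by split=> //; rewrite -pq.
Qed.

Lemma germ_rel_trans : transitive germ_rel.
Proof.
move=> q p r /asboolP[pq [e [ee ez pe]]] /asboolP[qr [f [ff fz qf]]].
apply/asboolP; split; first by rewrite pq.
exists (e * f); split; first exact: idempM.
  by apply/adom_idempM; rewrite // pq; split=> //; rewrite -pq.
by rewrite mulgA pe -mulgA (idempC ee ff) !mulgA qf.
Qed.

Canonical germ_equiv := EquivRel germ_rel germ_rel_refl germ_rel_sym germ_rel_trans.

Definition germ : Type := {eq_quot germ_equiv}.

HB.instance Definition _ := Choice.copy germ {eq_quot germ_equiv}.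

Definition germ_of p : germ := \pi_{eq_quot germ_equiv} p.
Definition germ_repr (g : germ) : germ_pair := repr (g : {eq_quot germ_equiv}).

Lemma germ_reprK g : germ_of (germ_repr g) = g.
Proof. exact: reprK. Qed.

Lemma germ_ofP p q : germ_of p = germ_of q <->
  (val p).2 = (val q).2 /\ exists e : S,
      [/\ idemp e, adom a e (val p).2 & (val p).1 * e = (val q).1 * e].
Proof.
split; first by move/eqP; rewrite /germ_of eqmodE => /asboolP.
by move=> h; apply/eqP; rewrite /germ_of eqmodE; apply/asboolP.
Qed.

Definition mkgerm t z (h : adom a (t^* * t) z) : germ :=
  germ_of (exist (fun p : S * Z => p \in germ_dom) (t, z) (mem_set h)).

Lemma mkgermP t u z w (h : adom a (t^* * t) z) (h' : adom a (u^* * u) w) :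
  mkgerm h = mkgerm h' <->
  z = w /\ exists e : S, [/\ idemp e, adom a e z & t * e = u * e].
Proof. exact: germ_ofP. Qed.

Lemma mkgerm_eq t z w (h : adom a (t^* * t) z) (h' : adom a (t^* * t) w) :
  z = w -> mkgerm h = mkgerm h'.
Proof.
move=> zw; apply/mkgermP; split=> //; exists (t^* * t); split=> //.
exact: idemp_starl.
Qed.

Lemma germ_of_mkgerm p (h : adom a ((val p).1^* * (val p).1) (val p).2) :
  germ_of p = mkgerm h.
Proof. by congr germ_of; apply: val_inj => /=; case: (val p). Qed.

Lemma germW g : exists t z (h : adom a (t^* * t) z), g = mkgerm h.
Proof.
have h := set_mem (valP (germ_repr g)); exists _, _, h.
by rewrite -[LHS]germ_reprK; exact: germ_of_mkgerm.
Qed.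

(* [{[t, z] : z in V}], for [V] a subset of [adom (t^* * t)] *)
Definition germ_slice (t : S) (V : set Z) : set germ :=
  germ_of @` [set p | (val p).1 = t /\ V (val p).2].

Lemma germ_sliceP t V g : germ_slice t V g <->
  exists z (h : adom a (t^* * t) z), V z /\ g = mkgerm h.
Proof.
split=> [[p [pt pV] <-]|[z [h [Vz ->]]]]; last first.
  by rewrite /mkgerm; eexists; last reflexivity.
have h : adom a ((val p).1^* * (val p).1) (val p).2 := set_mem (valP p).
have h' : adom a (t^* * t) (val p).2 by rewrite -pt.
exists (val p).2, h'; split=> //; rewrite (germ_of_mkgerm h).
apply/mkgermP; split=> //; exists (t^* * t); rewrite pt.
by split=> //; exact: idemp_starl.
Qed.

Lemma germ_slice_mk t V z (h : adom a (t^* * t) z) : V z -> germ_slice t V (mkgerm h).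
Proof. by move=> Vz; apply/germ_sliceP; exists z, h. Qed.

Definition germ_open (A : set germ) := forall g, A g -> exists t V,
  [/\ open V, V `<=` adom a (t^* * t), germ_slice t V g & germ_slice t V `<=` A].

Lemma germ_openT : germ_open setT.
Proof.
move=> g _; have [t [z [h ->]]] := germW g.
exists t, (adom a (t^* * t)); split=> //; first exact: adom_open.
exact: germ_slice_mk.
Qed.

Lemma germ_openI : setI_closed germ_open.
Proof.
move=> A B oA oB g [/oA[t [V [oV VD tVg tVA]]] /oB[u [W [oW WD uWg uWB]]]].
have /germ_sliceP[z [h [Vz ge]]] := tVg.
have /germ_sliceP[w [h' [Ww]]] := uWg.
rewrite ge => /mkgermP[zw [e [ee ez teue]]].
exists t, (V `&` W `&` adom a e); split.
- by apply: openI; [exact: openI|exact: adom_idemp_open].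
- by move=> x [[/VD]].
- by apply: germ_slice_mk; split=> //; split=> //; rewrite zw.
move=> _ /germ_sliceP[x [k [[[Vx Wx] ex] ->]]]; split.
  by apply: tVA; exact: germ_slice_mk.
have -> : mkgerm k = mkgerm (WD _ Wx) by apply/mkgermP; split=> //; exists e.
by apply: uWB; exact: germ_slice_mk.
Qed.

Lemma germ_open_bigU (I : Type) (f : I -> set germ) :
  (forall i, germ_open (f i)) -> germ_open (\bigcup_i f i).
Proof.
move=> of_ g [i _ /(of_ i)[t [V [oV VD tVg tVf]]]].
by exists t, V; split=> // x /tVf; exists i.
Qed.

HB.instance Definition _ :=
  isOpenTopological.Build germ germ_openT germ_openI germ_open_bigU.

Lemma germ_openE (A : set germ) : open A = germ_open A.
Proof. by []. Qed.

Lemma germ_slice_open t V : open V -> V `<=` adom a (t^* * t) ->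
  open (germ_slice t V).
Proof. by move=> oV VD; rewrite germ_openE => g gV; exists t, V; split. Qed.

Definition germ_src (g : germ) : Z := (val (germ_repr g)).2.

Definition germ_rng (g : germ) : Z :=
  act a (val (germ_repr g)).1 (val (germ_repr g)).2.

(* [t, z][u, w] = [t * u, w] if z = act u w; other products are junk. *)
Definition germ_mul (g h : germ) : germ :=
  let p := val (germ_repr g) in let q := val (germ_repr h) in
  germ_of (insubd (germ_repr h) (p.1 * q.1, q.2)).

Definition germ_inv (g : germ) : germ :=
  let p := val (germ_repr g) in
  germ_of (insubd (germ_repr g) (p.1^*, act a p.1 p.2)).

Lemma adom_one_in z : adom a (1^* * 1) z. Proof. by rewrite adom_one. Qed.

Definition germ_unit (z : Z) : germ := mkgerm (adom_one_in z).

Lemma insubd_germ d t z (h : adom a (t^* * t) z) :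
  germ_of (insubd d (t, z)) = mkgerm h.
Proof.
by congr germ_of; apply: val_inj => /=; rewrite val_insubd /= mem_set.
Qed.

Lemma germ_repr_mk t z (h : adom a (t^* * t) z) :
  exists t' (h' : adom a (t'^* * t') z), [/\ val (germ_repr (mkgerm h)) = (t', z),
    mkgerm h' = mkgerm h & act a t' z = act a t z].
Proof.
have := germ_reprK (mkgerm h); case: (germ_repr _) => -[t' w] /= k.
have k' : adom a (t'^* * t') w by exact: (set_mem k).
rewrite (@germ_of_mkgerm (exist (fun p : S * Z => p \in germ_dom) _ k) k') => kh.
have /mkgermP[/= wz [e [ee ew teue]]] := kh.
have [_ tt'] := germ_eq_act ee ew teue k'.
by case: _ / wz h kh tt' => h kh tt'; exists t', k'.
Qed.

Lemma germ_src_mk t z (h : adom a (t^* * t) z) : germ_src (mkgerm h) = z.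
Proof. by rewrite /germ_src; have [t' [h' [-> _ _]]] := germ_repr_mk h. Qed.

Lemma germ_rng_mk t z (h : adom a (t^* * t) z) : germ_rng (mkgerm h) = act a t z.
Proof. by rewrite /germ_rng; have [t' [h' [-> _]]] := germ_repr_mk h. Qed.

Lemma adom_conj u e z : idemp e -> adom a (u^* * u) z -> adom a e (act a u z) ->
  adom a (u^* * e * u) z.
Proof.
move=> ee uz euz; have c := idemp_conj u ee.
suff : adom a ((u^* * e * u)^* * (u^* * e * u)) z by rewrite (idemp_star c) c.
by rewrite adom_mul; split=> //=; apply/adom_mul_idemp => //; split=> //; exact: adom_star.
Qed.

Lemma germ_mul_mk t u w z (h : adom a (t^* * t) w) (k : adom a (u^* * u) z)
    (l : adom a ((t * u)^* * (t * u)) z) :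
  w = act a u z -> germ_mul (mkgerm h) (mkgerm k) = mkgerm l.
Proof.
move=> wz; rewrite /germ_mul.
have [t' [h' [-> /mkgermP[_ [e [ee ew te]]] _]]] := germ_repr_mk h.
have [u' [k' [uE kk act_u]]] := germ_repr_mk k; rewrite uE /=.
have /mkgermP[_ [f [ff fz uf]]] := kk.
have l' : adom a ((t' * u')^* * (t' * u')) z.
  by apply: adom_mulP => //; rewrite act_u -wz.
rewrite (insubd_germ _ l'); apply/mkgermP; split=> //.
have cc := idemp_conj u ee.
exists (f * (u^* * e * u)); split; first exact: idempM.
  by apply/adom_idempM => //; split=> //; apply: adom_conj; rewrite -?wz.
have E x : x * u * (f * (u^* * e * u)) = x * e * u * f.
  by rewrite (idempC ff cc) mulgA -(mulgA x u) -(idemp_conjr u ee) mulgA.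
transitivity (t' * u * (f * (u^* * e * u))); last by rewrite !E te.
by rewrite -[in LHS]mulgA (mulgA u' f) uf !mulgA.
Qed.

Lemma germ_inv_mk t z (h : adom a (t^* * t) z)
    (k : adom a (t^*^* * t^*) (act a t z)) :
  germ_inv (mkgerm h) = mkgerm k.
Proof.
rewrite /germ_inv; have [t' [h' [-> /mkgermP[_ [e [ee ez te]]] tt']]] /= :=
  germ_repr_mk h.
have k' : adom a (t'^*^* * t'^*) (act a t' z) by exact: adom_star.
rewrite (insubd_germ _ k'); apply/mkgermP; split=> //.
have te' : e * t'^* = e * t^*.
  by have := congr1 (@star S) te; rewrite !starM (idemp_star ee).
have E x : x^* * (x * e * x^*) = e * x^*.
  rewrite !mulgA -(idempC ee (idemp_starl x)) -!mulgA (mulgA x^*).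
  by rewrite star_mulgK.
have EE : t' * e * t'^* = t * e * t^* by rewrite te -!mulgA te'.
exists (t * e * t^*); split.
- by have := idemp_conj t^* ee; rewrite starK.
- have := adom_conj ee (adom_star h); rewrite actK// tt'.
  by move=> /(_ ez); rewrite (starK t).
by rewrite E -EE E te'.
Qed.

Lemma germ_src_continuous : continuous germ_src.
Proof.
apply/continuousP => A oA; rewrite germ_openE => g.
have [t [z [h ->]]] := germW g; rewrite /= germ_src_mk => Az.
exists t, (A `&` adom a (t^* * t)); split.
- by apply: openI => //; exact: adom_open.
- by move=> ? [].
- exact: germ_slice_mk.
by move=> _ /germ_sliceP[x [k [[Ax _] ->]]] /=; rewrite germ_src_mk.
Qed.

Lemma open_local (X : topologicalType) (A : set X) :
  (forall x, A x -> exists U, [/\ open U, U x & U `<=` A]) -> open A.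
Proof.
move=> h; rewrite openE => x /h[U [oU Ux UA]].
by rewrite /interior nbhsE; exists U.
Qed.

Lemma germ_src_open : open_map germ_src.
Proof.
move=> A; rewrite germ_openE => oA; apply: open_local => _ [g Ag <-].
have [t [V [oV VD /germ_sliceP[z [h [Vz ge]]] tVA]]] := oA _ Ag.
exists V; split=> //; first by rewrite ge germ_src_mk.
move=> x Vx; exists (mkgerm (VD _ Vx)); last exact: germ_src_mk.
by apply: tVA; exact: germ_slice_mk.
Qed.

Lemma act_preimage_open t A : open A ->
  open (adom a (t^* * t) `&` act a t @^-1` A).
Proof.
move=> oA; have [oD _ _ ct _] := act_homeo a t.
by apply: (continuous_inP _ oD).1 => //; rewrite -continuous_open_subspace.
Qed.

Lemma germ_inv_continuous : continuous germ_inv.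
Proof.
apply/continuousP => A; rewrite !germ_openE => oA g.
have [t [z [h ->]]] := germW g; rewrite /preimage /=.
rewrite (germ_inv_mk h (adom_star h)) => /oA.
move=> [u [W [oW WD /germ_sliceP[w [k [Ww gk]]] uWA]]].
have /mkgermP[zw [e [ee ez te]]] := gk.
exists t, (adom a (t^* * t) `&` act a t @^-1` (W `&` adom a e)); split.
- by apply: act_preimage_open; apply: openI => //; exact: adom_idemp_open.
- by move=> ? [].
- by apply: germ_slice_mk; split=> //=; rewrite zw in ez *.
move=> _ /germ_sliceP[x [l [[_ [Wx ex]] ->]]]; rewrite /= (germ_inv_mk l (adom_star l)).
apply: uWA; have -> : mkgerm (adom_star l) = mkgerm (WD _ Wx).
  by apply/mkgermP; split=> //; exists e.
exact: germ_slice_mk.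
Qed.

Lemma germ_rngE : germ_rng = germ_src \o germ_inv.
Proof.
apply/funext => g; have [t [z [h ->]]] := germW g.
by rewrite /= (germ_inv_mk h (adom_star h)) germ_src_mk germ_rng_mk.
Qed.

Lemma germ_invK : involutive germ_inv.
Proof.
move=> g; have [t [z [h ->]]] := germW g.
rewrite (germ_inv_mk h (adom_star h)) (germ_inv_mk _ (adom_star (adom_star h))).
apply/mkgermP; rewrite actK// starK; split=> //.
by exists (t^* * t); split=> //; exact: idemp_starl.
Qed.

Lemma germ_rng_continuous : continuous germ_rng.
Proof.
rewrite germ_rngE => g; apply: continuous_comp; first exact: germ_inv_continuous.
exact: germ_src_continuous.
Qed.

Lemma germ_rng_open : open_map germ_rng.
Proof.
move=> A oA; rewrite germ_rngE -image_comp.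
rewrite (_ : germ_inv @` A = germ_inv @^-1` A).
  by apply: germ_src_open; move/continuousP: germ_inv_continuous; exact.
apply/seteqP; split=> [_ [g Ag <-]|g Ag] /=; first by rewrite germ_invK.
by exists (germ_inv g) => //; rewrite germ_invK.
Qed.

Lemma germ_unit_continuous : continuous germ_unit.
Proof.
apply/continuousP => A; rewrite germ_openE => oA; apply: open_local => z /oA.
move=> [t [V [oV VD /germ_sliceP[w [k [Vw gk]]] tVA]]].
have /mkgermP[zw [e [ee ez te]]] := gk.
exists (V `&` adom a e); split; first by apply: openI => //; exact: adom_idemp_open.
  by split=> //; rewrite zw.
move=> x [Vx ex]; apply: tVA; rewrite /germ_unit.
have -> : mkgerm (adom_one_in x) = mkgerm (VD _ Vx).
  by apply/mkgermP; split=> //; exists e.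
exact: germ_slice_mk.
Qed.

Lemma germ_composable g h : germ_src g = germ_rng h ->
  exists t u z (k : adom a (u^* * u) z) (l : adom a (t^* * t) (act a u z)),
  g = mkgerm l /\ h = mkgerm k.
Proof.
have [t [w [l ->]]] := germW g; have [u [z [k ->]]] := germW h.
rewrite germ_src_mk germ_rng_mk => wz; case: _ / (esym wz) l => l.
by exists t, u, z, k, l.
Qed.

Lemma germ_mul_continuous :
  {within [set gh : germ * germ | germ_src gh.1 = germ_rng gh.2],
    continuous (fun gh => germ_mul gh.1 gh.2)}.
Proof.
apply/subspace_continuousP => -[g h] /= /germ_composable.
move=> [t [u [z [k [l [-> ->]]]]]] A.
rewrite nbhsE => -[B [oB Bg] BA].
have {}Bg : B (germ_mul (mkgerm l) (mkgerm k)) by exact: Bg.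
rewrite (germ_mul_mk l k (adom_mulP k l)) // in Bg.
rewrite germ_openE in oB.
have [w [W [oW WD /germ_sliceP[x [m [Wx gk]]] wWB]]] := oB _ Bg.
have /mkgermP[zx [e [ee ez te]]] := gk.
pose V := adom a (u^* * u) `&` (W `&` adom a e).
exists (germ_slice t (adom a (t^* * t)), germ_slice u V).
  split=> /=; apply: open_nbhs_nbhs; split.
  - by apply: germ_slice_open => //; exact: adom_open.
  - exact: germ_slice_mk.
  - apply: germ_slice_open; last by move=> ? [].
    by apply: openI; [exact: adom_open|apply: openI => //; exact: adom_idemp_open].
  - by apply: germ_slice_mk; split=> //; split=> //; rewrite zx.
move=> [_ _] [/= /germ_sliceP[y [m1 [_ ->]]] /germ_sliceP[v [m2 [[_ [Wv ev]] ->]]]].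
rewrite germ_src_mk germ_rng_mk => yv; case: _ / (esym yv) m1 => m1.
change (A (germ_mul (mkgerm m1) (mkgerm m2))).
rewrite (germ_mul_mk m1 m2 (adom_mulP m2 m1))//; apply/BA/wWB.
have -> : mkgerm (adom_mulP m2 m1) = mkgerm (WD _ Wv).
  by apply/mkgermP; split=> //; exists e.
exact: germ_slice_mk.
Qed.

Lemma germ_rng_unit z : germ_rng (germ_unit z) = z.
Proof. by rewrite /germ_unit germ_rng_mk act_one. Qed.

Lemma germ_src_unit z : germ_src (germ_unit z) = z.
Proof. exact: germ_src_mk. Qed.

Lemma germ_rng_mul g h : germ_src g = germ_rng h ->
  germ_rng (germ_mul g h) = germ_rng g.
Proof.
move=> /germ_composable[t [u [z [k [l [-> ->]]]]]].
by rewrite (germ_mul_mk l k (adom_mulP k l))// !germ_rng_mk act_mul//; exact: adom_mulP.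
Qed.

Lemma germ_src_mul g h : germ_src g = germ_rng h ->
  germ_src (germ_mul g h) = germ_src h.
Proof.
move=> /germ_composable[t [u [z [k [l [-> ->]]]]]].
by rewrite (germ_mul_mk l k (adom_mulP k l))// !germ_src_mk.
Qed.

Lemma mkgerm_transport t u z (h : adom a (t^* * t) z) (k : adom a (u^* * u) z) :
  t = u -> mkgerm h = mkgerm k.
Proof. by move=> tu; case: _ / tu k => k; exact: mkgerm_eq. Qed.

Lemma germ_mulA g h k : germ_src g = germ_rng h -> germ_src h = germ_rng k ->
  germ_mul g (germ_mul h k) = germ_mul (germ_mul g h) k.
Proof.
move=> gh /germ_composable[t [u [z [k1 [k2 [hE ->]]]]]].
move: gh; rewrite hE.
have [v [w [k3 ->]]] := germW g; rewrite germ_src_mk germ_rng_mk => wE.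
case: _ / (esym wE) k3 => k3.
have k21 := adom_mulP k1 k2; have k32 := adom_mulP k2 k3.
have E : act a (t * u) z = act a t (act a u z) by rewrite act_mul.
have k3' : adom a (v^* * v) (act a (t * u) z) by rewrite E.
rewrite (germ_mul_mk k2 k1 k21)// (germ_mul_mk k3 k2 k32)//.
rewrite (germ_mul_mk k3 k21 (adom_mulP k21 k3'))//.
rewrite (germ_mul_mk k32 k1 (adom_mulP k1 k32))//.
by apply: mkgerm_transport; rewrite mulgA.
Qed.

Lemma germ_unit_mul g : germ_mul (germ_unit (germ_rng g)) g = g.
Proof.
have [t [z [h ->]]] := germW g; rewrite germ_rng_mk.
rewrite (germ_mul_mk _ h (adom_mulP h (adom_one_in _)))//.
by apply: mkgerm_transport; rewrite mul1g.
Qed.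

Lemma germ_mul_unit g : germ_mul g (germ_unit (germ_src g)) = g.
Proof.
have [t [z [h ->]]] := germW g; rewrite germ_src_mk.
have h' : adom a (t^* * t) (act a 1 z) by rewrite act_one.
rewrite (germ_mul_mk h _ (adom_mulP (adom_one_in z) h')) ?act_one//.
by apply: mkgerm_transport; rewrite mulg1.
Qed.

Lemma germ_rng_inv g : germ_rng (germ_inv g) = germ_src g.
Proof. by rewrite germ_rngE /= germ_invK. Qed.

Lemma germ_src_inv g : germ_src (germ_inv g) = germ_rng g.
Proof. by rewrite germ_rngE. Qed.

Lemma germ_inv_mul g : germ_mul (germ_inv g) g = germ_unit (germ_src g).
Proof.
have [t [z [h ->]]] := germW g.
rewrite (germ_inv_mk h (adom_star h)) germ_src_mk.
rewrite (germ_mul_mk _ h (adom_mulP h (adom_star h)))//; apply/mkgermP; split=> //.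
exists (t^* * t); split=> //; first exact: idemp_starl.
by rewrite idemp_starl mul1g.
Qed.

Lemma germ_mul_inv g : germ_mul g (germ_inv g) = germ_unit (germ_rng g).
Proof. by rewrite -{1}[g]germ_invK germ_inv_mul germ_src_inv. Qed.

Definition germ_groupoid : topGroupoid := {|
  obj := Z; arr := germ;
  rng := germ_rng; src := germ_src;
  gmul := germ_mul; ginv := germ_inv; gunit := germ_unit;
  rng_continuous := germ_rng_continuous;
  rng_open := germ_rng_open;
  src_continuous := germ_src_continuous;
  src_open := germ_src_open;
  gmul_continuous := germ_mul_continuous;
  ginv_continuous := germ_inv_continuous;
  gunit_continuous := germ_unit_continuous;
  rng_gunit := germ_rng_unit;
  src_gunit := germ_src_unit;
  rng_gmul := germ_rng_mul;
  src_gmul := germ_src_mul;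
  gmulA := germ_mulA;
  gunit_gmul := germ_unit_mul;
  gmul_gunit := germ_mul_unit;
  rng_ginv := germ_rng_inv;
  src_ginv := germ_src_inv;
  ginv_gmul := germ_inv_mul;
  gmul_ginv := germ_mul_inv |}.

End Germs.

Record is_grading (S : invMonoidType) (L : topGroupoid)
    (Lt : S -> set (arr L)) : Prop := IsGrading {
  grading_open : forall t, open (Lt t);
  grading_mul : forall t u,
    [set gmul gh.1 gh.2 | gh in [set gh : arr L * arr L |
      [/\ Lt t gh.1, Lt u gh.2 & src gh.1 = rng gh.2]]] = Lt (t * u);
  grading_inv : forall t, @ginv L @` Lt t = Lt t^*;
  grading_meet : forall t u,
    Lt t `&` Lt u = \bigcup_(v in [set v | nat_le v t /\ nat_le v u]) Lt v;
  grading_cover : \bigcup_(t in setT) Lt t = setT }.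

Section Orbits.
Variables (L : topGroupoid) (G : wide_subgroupoid L).

Definition orbit_rel : rel (obj L) :=
  fun x y => `[< exists g, [/\ sub_arr G g, src g = x & rng g = y] >].

Lemma orbit_rel_refl : reflexive orbit_rel.
Proof.
move=> x; apply/asboolP; exists (gunit x).
by rewrite src_gunit rng_gunit; split=> //; exact: sub_gunit.
Qed.

Lemma orbit_rel_sym : symmetric orbit_rel.
Proof.
suff s x y : orbit_rel x y -> orbit_rel y x by move=> x y; apply/idP/idP; exact: s.
move=> /asboolP[g [Gg gx gy]]; apply/asboolP; exists (ginv g).
by rewrite src_ginv rng_ginv; split=> //; exact: sub_ginv.
Qed.

Lemma orbit_rel_trans : transitive orbit_rel.
Proof.
move=> y x z /asboolP[g [Gg gx gy]] /asboolP[h [Gh hy hz]]; apply/asboolP.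
have hg : src h = rng g by rewrite hy.
exists (gmul h g); rewrite src_gmul// rng_gmul//; split=> //.
exact: sub_gmul.
Qed.

Canonical orbit_equiv :=
  EquivRel orbit_rel orbit_rel_refl orbit_rel_sym orbit_rel_trans.

Definition orbit_space : topologicalType :=
  quotient_topology {eq_quot orbit_equiv}.

Definition orb (x : obj L) : orbit_space := \pi_{eq_quot orbit_equiv} x.

Lemma orbP x y : orb x = orb y <-> exists g, [/\ sub_arr G g, src g = x & rng g = y].
Proof.
by split=> [/(eqmodP orbit_equiv)/asboolP|h] //; exact/(eqmodP orbit_equiv)/asboolP.
Qed.

Definition invariant_map (Z : Type) (rho : obj L -> Z) :=
  forall g, sub_arr G g -> rho (rng g) = rho (src g).

Definition descend (Z : Type) (rho : obj L -> Z) (p : orbit_space) : Z :=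
  rho (repr (p : {eq_quot orbit_equiv})).

Lemma descendE (Z : Type) (rho : obj L -> Z) x :
  invariant_map rho -> descend rho (orb x) = rho x.
Proof.
move=> inv; set y := repr (orb x : {eq_quot orbit_equiv}).
have /orbP[g [Gg gy gx]] : orb y = orb x by exact: reprK.
by rewrite /descend -/y -gy -gx inv.
Qed.

Variables (S : invMonoidType) (Lt : S -> set (arr L)).

Definition grading_dom (t : S) : set (obj L) := @src L @` Lt t.

(* [t . [x] = [rng l]] for any [l] in [Lt t] with [src l] in the orbit [x]; the
   value outside of the image of [grading_dom t] is irrelevant. *)
Definition induced_act (t : S) (p : orbit_space) : orbit_space :=
  xget p [set q | exists l, [/\ Lt t l, orb (src l) = p & orb (rng l) = q]].

Lemma induced_actE t l : is_grading Lt -> Lt 1 = G -> Lt t l ->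
  induced_act t (orb (src l)) = orb (rng l).
Proof.
move=> gr L1 tl; rewrite /induced_act.
case: xgetP => [q -> [k [tk /orbP[g [Gg gk gl]] <-]]|]; last first.
  by move=> /(_ (orb (rng l))); case; exists l.
apply/orbP; exists (gmul l (gmul g (ginv k))).
have gk' : src g = rng (ginv k) by rewrite rng_ginv gk.
have lgk : src l = rng (gmul g (ginv k)) by rewrite rng_gmul.
split; [|by rewrite src_gmul// src_gmul// src_ginv|by rewrite rng_gmul].
have : Lt (t * (1 * t^*)) (gmul l (gmul g (ginv k))).
  rewrite -(grading_mul gr); exists (l, gmul g (ginv k)) => //; split=> //=.
  rewrite -(grading_mul gr); exists (g, ginv k) => //; split=> //=.
    by rewrite L1.
  by rewrite -(grading_inv gr); exists k.
rewrite mul1g -L1 => tt; suff [] : (Lt 1 `&` Lt (t * t^*)) (gmul l (gmul g (ginv k))) by [].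
rewrite (grading_meet gr); exists (t * t^*) => //; split.
  by exists (t * t^*); [exact: idemp_starr|rewrite mul1g].
by exists 1; [rewrite /idemp mulg1|rewrite mulg1].
Qed.

End Orbits.

Record equivariant (S : invMonoidType) (Z : topologicalType) (a : action S Z)
    (L : topGroupoid) (G : wide_subgroupoid L) (Lt : S -> set (arr L))
    (rho : obj L -> Z) : Prop := Equivariant {
  equivariant_dom : forall t, rho @^-1` adom a (t^* * t) = grading_dom Lt t;
  equivariant_act : forall t x, grading_dom Lt t x ->
    descend (G := G) rho (induced_act Lt t (orb G x)) = act a t (rho x) }.

Record graded_map (S : invMonoidType) (Z : topologicalType) (a : action S Z)
    (L : topGroupoid) (G : wide_subgroupoid L) (Lt : S -> set (arr L))
    (rho : obj L -> Z) : Prop := GradedMap {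
  graded_map_grading : is_grading Lt;
  graded_map_unit : Lt 1 = G;
  graded_map_continuous : continuous rho;
  graded_map_invariant : invariant_map G rho;
  graded_map_equivariant : equivariant a G Lt rho }.

Definition germs_at (S : invMonoidType) (Z : topologicalType) (a : action S Z)
  (t : S) : set (germ a) := germ_slice t (adom a (t^* * t)).
Arguments germs_at {S Z} a t.

Definition grading_of (S : invMonoidType) (Z : topologicalType)
    (a : action S Z) (L : topGroupoid) (F : functor L (germ_groupoid a)) :
    (S -> set (arr L)) * (obj L -> Z) :=
  (fun t => farr F @^-1` germs_at a t, fobj F).

(* Main.v *)
Require Import Defs.
From HB Require Import structures.
From mathcomp Require Import all_boot all_classical topology.

Set Implicit Arguments.
Unset Strict Implicit.
Unset Printing Implicit Defensive.

Local Open Scope classical_set_scope.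
Local Open Scope group_scope.

(** A fibration [F] is recovered from [L_t = F^-1 {[t, z] : z in D_(t^*t)}] and
    [rho = F^0]: an arrow [g] of [L_t] can only be sent to [[t, rho (s g)]].
    Conversely this formula defines [F] from a grading and an equivariant
    [rho]; it does not depend on [t] because of the formula for [L_t `&` L_u].
    The key point is that if [[t, z] = [u, z]] for an arrow [g] of [L_t] with
    [z = rho (s g)], then [t e = u e] for some [e] with [z] in [D_e]; by
    equivariance [g] is composable with an arrow [h] of [L_e], so that
    [g = (g h^-1) h] belongs to [L_(te) = L_(ue)], which is contained in [L_u]. *)

(** * The natural partial order of an inverse monoid *)

Section NaturalOrder.
Variables (S : invMonoidType).
Implicit Types t u v e : S.

Lemma nat_le_refl t : nat_le t t.
Proof.
by exists (t^* * t); [exact: idemp_starl|rewrite mulgA mulg_starK].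
Qed.

Lemma nat_le_mulr t e : idemp e -> nat_le (t * e) t.
Proof. by move=> ee; exists e. Qed.

(** The unspecified idempotent behind [v <= t] can be replaced by [v^* * v], because idempotents
    commute. *)
Lemma nat_leE v t : nat_le v t -> t * (v^* * v) = v.
Proof.
move=> [e ee ->]; rewrite starM (idemp_star ee) !mulgA.
transitivity (t * (e * (t^* * t)) * e); first by rewrite !mulgA.
by rewrite (idempC ee (idemp_starl t)) -!mulgA ee !mulgA mulg_starK.
Qed.

End NaturalOrder.

Lemma open_setX (X Y : topologicalType) (A : set X) (B : set Y) :
  open A -> open B -> open (A `*` B).
Proof.
move=> oA oB; rewrite openE => -[x y] [/= Ax By].
by exists (A, B) => //; split; exact: open_nbhs_nbhs.
Qed.

(** * The slices [germs_at a t] of the groupoid of germs *)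

Section GermsAt.
Variables (S : invMonoidType) (Z : topologicalType) (a : action S Z).
Implicit Types (t u v e : S) (z : Z).

Lemma adom_nat_le v t z : nat_le v t ->
  adom a (v^* * v) z -> adom a (t^* * t) z.
Proof. by move=> [e ee ->] /(adom_mul_idemp a t z ee)[]. Qed.

(** The witness is [v^* * v]: multiplying [t] or [v] by it on the right gives [v]. *)
Lemma mkgerm_nat_le v t z (h : adom a (v^* * v) z) (k : adom a (t^* * t) z) :
  nat_le v t -> mkgerm h = mkgerm k.
Proof.
move=> vt; apply/mkgermP; split=> //; exists (v^* * v); split=> //.
  exact: idemp_starl.
by rewrite (nat_leE vt) mulgA mulg_starK.
Qed.

Lemma germs_at_mk t z (h : adom a (t^* * t) z) : germs_at a t (mkgerm h).
Proof. exact: germ_slice_mk. Qed.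

Lemma germs_atP t g : germs_at a t g <->
  exists h : adom a (t^* * t) (germ_src g), g = mkgerm h.
Proof.
split=> [/germ_sliceP[z [h [_ ->]]]|[h ->]]; last exact: germs_at_mk.
by have k := h; rewrite -(germ_src_mk h) in k; exists k; apply: mkgerm_eq; rewrite germ_src_mk.
Qed.

Lemma germs_at_open t : open (germs_at a t).
Proof. by apply: germ_slice_open => //; exact: adom_open. Qed.

(** The source map is injective on a slice; equalities of germs below are reduced to equalities of
    sources through this. *)
Lemma germs_at_inj t g h :
  germs_at a t g -> germs_at a t h -> germ_src g = germ_src h -> g = h.
Proof.
by move=> /germs_atP[k ->] /germs_atP[l ->]; rewrite !germ_src_mk; exact: mkgerm_eq.
Qed.

Lemma germs_at_mul t u g h : germs_at a t g -> germs_at a u h ->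
  germ_src g = germ_rng h -> germs_at a (t * u) (germ_mul g h).
Proof.
move=> /germs_atP[k ->] /germs_atP[l ->]; rewrite germ_src_mk germ_rng_mk => E.
have k' : adom a (t^* * t) (act a u (germ_src h)) by rewrite -E.
by rewrite (germ_mul_mk k l (adom_mulP l k'))//; exact: germs_at_mk.
Qed.

Lemma germs_at_inv t g : germs_at a t g -> germs_at a t^* (germ_inv g).
Proof.
by move=> /germs_atP[k ->]; rewrite (germ_inv_mk k (adom_star k)); exact: germs_at_mk.
Qed.

Lemma germs_at_dom t g : germs_at a t g -> adom a (t^* * t) (germ_src g).
Proof. by move=> /germs_atP[]. Qed.

Lemma germs_at_rng t g : germs_at a t g -> germ_rng g = act a t (germ_src g).
Proof. by move=> /germs_atP[h ->]; rewrite germ_rng_mk germ_src_mk. Qed.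

(** The slice of [1] is the set of units, so its preimage under a functor is the fibre. *)
Lemma germs_at1 g : germs_at a 1 g <-> g = germ_unit a (germ_src g).
Proof.
split=> [/germs_atP[h gh]|->]; last exact: germs_at_mk.
by rewrite {1}gh; exact: mkgerm_eq.
Qed.

(** If [e] witnesses that a germ comes from both [t] and [u], then it also comes from
    [t * e = u * e], which lies below both. *)
Lemma germs_at_meet t u : germs_at a t `&` germs_at a u =
  \bigcup_(v in [set v | nat_le v t /\ nat_le v u]) germs_at a v.
Proof.
apply/seteqP; split=> [g [/germs_atP[h gh] /germs_atP[k gk]]|g [v [vt vu]]].
  have [_ [e [ee ez te]]] := (mkgermP h k).1 (eq_trans (esym gh) gk).
  have l : adom a ((t * e)^* * (t * e)) (germ_src g) by apply/adom_mul_idemp.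
  have tet := nat_le_mulr t ee.
  exists (t * e); first by split=> //; rewrite te; exact: nat_le_mulr.
  by rewrite gh -(mkgerm_nat_le l h tet); exact: germs_at_mk.
move=> /germs_atP[h ->]; split.
  by rewrite (mkgerm_nat_le h (adom_nat_le vt h) vt); exact: germs_at_mk.
by rewrite (mkgerm_nat_le h (adom_nat_le vu h) vu); exact: germs_at_mk.
Qed.

End GermsAt.

(** * Identities in a groupoid and extensionality of functors *)

Section Groupoid.
Variable L : topGroupoid.
Implicit Types g h : arr L.

Lemma gmulVK g h : src g = src h -> gmul (gmul g (ginv h)) h = g.
Proof.
move=> gh; rewrite -gmulA ?rng_ginv ?src_ginv//.
by rewrite ginv_gmul -gh gmul_gunit.
Qed.

Lemma ginvK : involutive (@ginv L).
Proof.
move=> g; rewrite -[LHS]gmul_gunit src_ginv rng_ginv -ginv_gmul.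
rewrite gmulA ?src_ginv ?rng_ginv// ginv_gmul src_ginv.
by rewrite gunit_gmul.
Qed.

Lemma functor_eq (H : topGroupoid) (F F' : functor L H) :
  fobj F = fobj F' -> farr F = farr F' -> F = F'.
Proof.
case: F F' => [o m p1 p2 p3 p4 p5] [o' m' q1 q2 q3 q4 q5] /= oE mE.
case: _ / oE q1 q3 q4; case: _ / mE q2 q5 => q2 q5 q1 q3 q4.
by congr Functor; exact: Prop_irrelevance.
Qed.

End Groupoid.

(** * From a fibration to a grading with an equivariant map *)

Section FibrationToGrading.
Variables (S : invMonoidType) (Z : topologicalType) (a : action S Z).
Variables (L : topGroupoid) (F : functor L (germ_groupoid a)).

Let Lt t : set (arr L) := farr F @^-1` germs_at a t.

Lemma germ_src_farr g : germ_src (farr F g) = fobj F (src g).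
Proof. exact: (src_farr F). Qed.

Lemma germ_rng_farr g : germ_rng (farr F g) = fobj F (rng g).
Proof. exact: (rng_farr F). Qed.

Lemma fibre_germs_at1 : Lt 1 = fibre F.
Proof.
apply/seteqP; split=> g /=.
  by move=> /germs_at1; rewrite germ_src_farr.
by move=> Fg; apply/germs_at1; rewrite germ_src_farr.
Qed.

Hypothesis fibF : is_fibration F.

(** Surjectivity of [farr_src], applied to the pair of the germ [[t, fobj F x]] and [x]. *)
Lemma fibration_lift t x : adom a (t^* * t) (fobj F x) ->
  exists2 l, Lt t l & src l = x.
Proof.
move=> h; have hx : (mkgerm h, x) \in @fibre_product L (germ_groupoid a) F.
  by apply/mem_set; rewrite /fibre_product /= germ_src_mk.
have [l _ /(congr1 val)/= [Fl lx]] := fibF.2 (exist (fun p => p \in fibre_product F) _ hx) I.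
by exists l => //; rewrite /Lt /= Fl; exact: germs_at_mk.
Qed.

Lemma fibration_grading : is_grading Lt.
Proof.
split.
- move=> t; have /continuousP := @farr_continuous _ _ F; apply.
  exact: germs_at_open.
- move=> t u; apply/seteqP; split=> [_ [[g h] [/= tg uh gh] <-]|k tuk].
    rewrite /Lt /= farr_gmul//; apply: germs_at_mul => //.
    by rewrite germ_src_farr germ_rng_farr gh.
  (* To factor [k] in [Lt (t * u)], lift [u] at [src k] to an arrow [h] and write
     [k = (k h^-1) h]. *)
  have := germs_at_dom tuk; rewrite germ_src_farr adom_mul => -[ukz tkz].
  have [h uh hk] := fibration_lift ukz.
  have srh : src (gmul k (ginv h)) = rng h by rewrite src_gmul ?src_ginv ?rng_ginv.
  exists (gmul k (ginv h), h); last exact: gmulVK.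
  split=> //=; rewrite /Lt /=; have E : germ_rng (farr F h) = act a u (fobj F (src k)).
    by rewrite (germs_at_rng uh) germ_src_farr hk.
  (* To see that [k h^-1] is in [Lt t], compare it with a lift [l] of [t] at [rng h]: [k] and [l h]
     have the same image, hence so do [k h^-1] and [l]. *)
  have [l tl lh] : exists2 l, Lt t l & src l = rng h.
    by apply: fibration_lift; rewrite -germ_rng_farr E.
  have tulh : Lt (t * u) (gmul l h).
    rewrite /Lt /= farr_gmul//; apply: germs_at_mul => //.
    by rewrite germ_src_farr germ_rng_farr lh.
  have kE : farr F k = farr F (gmul l h).
    by apply: germs_at_inj tuk tulh _; rewrite !germ_src_farr src_gmul// hk.
  have lE : l = gmul (gmul l h) (ginv h).
    by rewrite -gmulA ?rng_ginv// gmul_ginv -lh gmul_gunit.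
  have -> : farr F (gmul k (ginv h)) = farr F l.
    rewrite [in RHS]lE !farr_gmul ?src_gmul ?rng_ginv//.
    by rewrite kE farr_gmul.
  exact: tl.
- move=> t; apply/seteqP; split=> [_ [g tg <-]|g tg].
    by rewrite /Lt /= farr_ginv; exact: germs_at_inv.
  exists (ginv g); last exact: ginvK.
  by rewrite /Lt /= farr_ginv -(starK t); exact: germs_at_inv.
- by move=> t u; rewrite -preimage_setI germs_at_meet preimage_bigcup.
- apply/seteqP; split=> // g _; have [t [z [h gh]]] := germW (farr F g).
  by exists t => //; rewrite /Lt /= gh; exact: germs_at_mk.
Qed.

Lemma fibration_graded_map (G : wide_subgroupoid L) :
  fibre F = G :> set (arr L) -> graded_map a G Lt (fobj F).
Proof.
move=> FG; have L1 : Lt 1 = G by rewrite fibre_germs_at1.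
have inv : invariant_map G (fobj F) by move=> g; rewrite -FG; exact: fibre_rng.
split=> //; [exact: fibration_grading|exact (@fobj_continuous _ _ F)|].
split=> [t|t _ [l tl <-]].
  apply/seteqP; split=> [x /fibration_lift[l tl <-]|_ [l tl <-]]; first by exists l.
  by rewrite /= -germ_src_farr; exact: germs_at_dom.
rewrite (induced_actE fibration_grading L1 tl) descendE// -germ_rng_farr.
by rewrite -germ_src_farr; exact: germs_at_rng.
Qed.

End FibrationToGrading.

(** * From a grading with an equivariant map to a fibration *)

Section GradingToFibration.
Variables (S : invMonoidType) (Z : topologicalType) (a : action S Z).
Variables (L : topGroupoid) (G : wide_subgroupoid L).
Variables (Lt : S -> set (arr L)) (rho : obj L -> Z).
Hypothesis gm : graded_map a G Lt rho.

Let gr : is_grading Lt := graded_map_grading gm.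
Let eqv := graded_map_equivariant gm.

Lemma grading_gmul t u g h : Lt t g -> Lt u h -> src g = rng h ->
  Lt (t * u) (gmul g h).
Proof. by move=> tg uh gh; rewrite -(grading_mul gr); exists (g, h). Qed.

Lemma grading_ginv t g : Lt t g -> Lt t^* (ginv g).
Proof. by move=> tg; rewrite -(grading_inv gr); exists g. Qed.

(** As [v] lies below both [t] and [v], the formula for [Lt t]&[Lt v] puts [Lt v] inside it. *)
Lemma grading_le v t : nat_le v t -> Lt v `<=` Lt t.
Proof.
move=> vt g vg; suff [] : (Lt t `&` Lt v) g by [].
by rewrite (grading_meet gr); exists v => //; split=> //; exact: nat_le_refl.
Qed.

Lemma grading_adom t g : Lt t g -> adom a (t^* * t) (rho (src g)).
Proof.
by move=> tg; have := equivariant_dom eqv t; rewrite seteqP => -[_]; apply; exists g.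
Qed.

Lemma grading_lift t x : adom a (t^* * t) (rho x) -> exists2 l, Lt t l & src l = x.
Proof. by have := equivariant_dom eqv t; rewrite seteqP => -[+ _]; apply. Qed.

(** Invariance of [rho] turns equivariance on orbits into a statement about single arrows. *)
Lemma grading_act t g : Lt t g -> rho (rng g) = act a t (rho (src g)).
Proof.
move=> tg; rewrite -(equivariant_act eqv); last by exists g.
rewrite (induced_actE gr (graded_map_unit gm) tg) descendE//.
exact: graded_map_invariant gm.
Qed.

Lemma grading_germ_eq t u g (h : adom a (t^* * t) (rho (src g)))
    (k : adom a (u^* * u) (rho (src g))) :
  Lt t g -> (mkgerm h = mkgerm k <-> Lt u g).
Proof.
move=> tg; split=> [/mkgermP[_ [e [ee ez teue]]]|ug].
  have [l el lg] : exists2 l, Lt e l & src l = src g.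
    by apply: grading_lift; rewrite (idemp_star ee) ee.
  apply: (@grading_le (u * e)); first exact: nat_le_mulr.
  rewrite -teue -(@gmulVK _ g l) ?lg//.
  have gl : src g = rng (ginv l) by rewrite rng_ginv lg.
  have := grading_gmul (grading_gmul tg (grading_ginv el) gl) el.
  by rewrite (idemp_star ee) -mulgA ee; apply; rewrite src_gmul// src_ginv.
(* Conversely, [g] lies in [Lt v] for some [v] below [t] and [u], and both germs equal the germ of
   [v]. *)
have : (Lt t `&` Lt u) g by [].
rewrite (grading_meet gr) => -[v [vt vu] vg].
have l := grading_adom vg.
by rewrite -(mkgerm_nat_le l h vt) (mkgerm_nat_le l k vu).
Qed.

Lemma grade_ex g : exists t, Lt t g.
Proof.
have [t _ tg] : (\bigcup_(t in setT) Lt t) g by rewrite (grading_cover gr).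
by exists t.
Qed.

Definition grading_farr (g : arr L) : germ a :=
  mkgerm (grading_adom (svalP (cid (grade_ex g)))).

Lemma grading_farrE t g (tg : Lt t g) : grading_farr g = mkgerm (grading_adom tg).
Proof. by apply/grading_germ_eq => //; exact: svalP (cid (grade_ex g)). Qed.

Lemma grading_farrP t g : germs_at a t (grading_farr g) <-> Lt t g.
Proof.
split=> [|tg]; last by rewrite (grading_farrE tg); exact: germs_at_mk.
move=> /germ_sliceP[z [h [_ gh]]]; have [zg _] := (mkgermP _ _).1 gh.
case: _ / zg h gh => h gh.
exact: (grading_germ_eq _ h (svalP (cid (grade_ex g)))).1 gh.
Qed.

(** On [Lt t] the map is [g |-> [t, rho (src g)]], so the slice of [t] over [V] pulls back to the
    arrows of [Lt t] with [rho (src g)] in [V]. *)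
Lemma grading_farr_continuous : continuous grading_farr.
Proof.
apply/continuousP => A; rewrite germ_openE => oA; apply: open_local => g /oA.
move=> [t [V [oV VD /germ_sliceP[z [h [Vz gh]]] tVA]]].
have tg : Lt t g by apply/grading_farrP; rewrite gh; exact: germs_at_mk.
exists (Lt t `&` (rho \o src (t:=L)) @^-1` V); split.
- apply: openI; first exact: grading_open gr t.
  apply: open_comp => // x _; apply: continuous_comp; first exact: src_continuous.
  exact: graded_map_continuous gm _.
- split=> //=; rewrite -(germ_src_mk (grading_adom tg)).
  by rewrite -(grading_farrE tg) gh germ_src_mk.
move=> k [tk Vk]; apply: tVA; rewrite (grading_farrE tk).
exact: germ_slice_mk.
Qed.

Lemma grading_farr_src g : germ_src (grading_farr g) = rho (src g).
Proof. exact: germ_src_mk. Qed.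

Lemma grading_farr_rng g : germ_rng (grading_farr g) = rho (rng g).
Proof.
by have [t tg] := grade_ex g; rewrite (grading_farrE tg) germ_rng_mk (grading_act tg).
Qed.

(** Both sides lie in the slice of [t * u] and have the same source. *)
Lemma grading_farr_gmul g h : src g = rng h ->
  grading_farr (gmul g h) = germ_mul (grading_farr g) (grading_farr h).
Proof.
move=> gh; have [t tg] := grade_ex g; have [u uh] := grade_ex h.
have E : germ_src (grading_farr g) = germ_rng (grading_farr h).
  by rewrite grading_farr_src grading_farr_rng gh.
apply: (@germs_at_inj _ _ _ (t * u)).
- by apply/grading_farrP; exact: grading_gmul.
- by apply: germs_at_mul => //; exact/grading_farrP.
by rewrite germ_src_mul// !grading_farr_src src_gmul.
Qed.

Definition grading_functor : functor L (germ_groupoid a) :=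
  @Functor L (germ_groupoid a) rho grading_farr
    (graded_map_continuous gm) grading_farr_continuous
    grading_farr_rng grading_farr_src grading_farr_gmul.

Lemma grading_functor_fibration : is_fibration grading_functor.
Proof.
split=> [U oU|[[p x] px] _].
  apply: open_local => _ [g Ug <-]; have [t tg] := grade_ex g.
  (* A point of the fibre product in [germs_at a t]*[W] is the image of some [k] in [U]&[Lt t]: the
     source of [k] is right by the choice of [W], and its germ by injectivity on the slice. *)
  pose W := src (t:=L) @` (U `&` Lt t).
  have oW : open W by apply: src_open; apply: openI => //; exact: grading_open gr t.
  exists (val @^-1` (germs_at a t `*` W)); split.
  - apply: open_comp => [y _|]; first exact: initial_continuous.
    apply: open_setX => //; exact: germs_at_open.
  - split=> /=; first exact/grading_farrP.
    by exists g.
  move=> [[q y] qy] [/= tq [k [Uk tk] ky]]; exists k => //.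
  apply: val_inj => /=; congr pair => //.
  apply: germs_at_inj tq _; first exact/grading_farrP.
  by rewrite grading_farr_src ky; exact/esym/(set_mem qy).
have [t [z [h ph]]] := germW p; have /= pz := set_mem px.
(* Surjectivity: [p] is a germ of [t] at [rho x], so an arrow of [Lt t] with source [x] is mapped to
   [(p, x)]. *)
have [l tl lx] : exists2 l, Lt t l & src l = x.
  by apply: grading_lift; rewrite -[rho x]pz /= ph germ_src_mk.
exists l => //; apply: val_inj => /=; congr pair => //.
apply: (@germs_at_inj _ _ _ t); first exact/grading_farrP.
  by rewrite ph; exact: germs_at_mk.
by rewrite grading_farr_src lx; exact/esym.
Qed.

Lemma grading_of_functor : grading_of grading_functor = (Lt, rho).
Proof.
congr pair; apply/funext => t; apply/seteqP.
by split=> g /grading_farrP.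
Qed.

Lemma grading_functor_fibre : fibre grading_functor = G :> set (arr L).
Proof.
rewrite -fibre_germs_at1 -(graded_map_unit gm).
exact: (congr1 (fun LR => LR.1 1) grading_of_functor).
Qed.

End GradingToFibration.

Theorem theorem3p1 (S : invMonoidType) (Z : topologicalType) (a : action S Z)
    (L : topGroupoid) (G : wide_subgroupoid L) :
  set_bij
    [set F : functor L (germ_groupoid a) |
      is_fibration F /\ fibre F = G :> set (arr L)]
    [set LR : (S -> set (arr L)) * (obj L -> Z) | graded_map a G LR.1 LR.2]
    (@grading_of S Z a L).
Proof.
split=> [F [fibF FG]|F F' _ _ [LE oE]|[Lt rho] /= gm].
- exact: fibration_graded_map.
(* Injectivity: equal gradings put both images of [g] in one slice, and equal object maps give them
   the same source. *)
- apply: functor_eq => //; apply/funext => g.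
  have [t [z [h gh]]] := germW (farr F g).
  have tg : germs_at a t (farr F g) by rewrite gh; exact: germs_at_mk.
  apply: (germs_at_inj tg); last by rewrite !germ_src_farr oE.
  by have := congr1 (fun P => P t g) LE => /= <-.
- exists (grading_functor gm); last exact: grading_of_functor.
  split; first exact: grading_functor_fibration.
  exact: grading_functor_fibre.
Qed.
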